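(* Let $E\subseteq M$ be star-shaped at $x_0\in E$ and let $f:E\to\mathbb{I}$, $f(x)=\langle f^c(x),f^w(x)\rangle$, be an interval-valued function. Assume that for every geodesic $\gamma:I\to M$, with $0\in I$, $\gamma(I)\subseteq E$, $\gamma(0)=x_0$ and $\dot\gamma(0)=X_{x_0}\in T_{x_0}(E)$, the function $(f^w\circ\gamma)(s)$ is non-decreasing for $s\in I\cap[0,\infty)$. Suppose that $f$ is gH-directionally differentiable at $x_0$. For $x\in E$ let $\Gamma_0$ be the collection of all geodesics $\gamma_{x_0x}:[0,1]\to M$ joining $x_0$ and $x$, with $\gamma_{x_0x}(0)=x_0$, $\gamma_{x_0x}(1)=x$ and $\dot\gamma_{x_0x}(0)=X_{x_0}\in T_{x_0}(E)$. Then: (i) if $f$ is cw-convex at $x_0$, then $$Df(x_0;X_{x_0})\leq^{\min}f(x)\ominus_{gH}f(x_0)\quad\text{for all }x\in E\text{ and all }\gamma_{x_0x}\in\Gamma_0;$$ (ii) if $f$ is strictly cw-convex at $x_0$, then $$Df(x_0;X_{x_0})<^{\min}f(x)\ominus_{gH}f(x_0)\quad\text{for all }x\in E,\ x\ne x_0,\text{ and all }\gamma_{x_0x}\in\Gamma_0,$$ where in both cases $X_{x_0}=\dot\gamma_{x_0x}(0)$.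
   Context: Throughout, $(M,g)$ is a complete finite-dimensional Riemannian manifold with its Riemannian connection. $\mathbb{I}$ is the set of closed bounded intervals of $\mathbb{R}$. An interval $A=[a^l,a^u]$ is also written $A=\langle a^c,a^w\rangle$ with center $a^c=\frac{a^l+a^u}{2}$ and half-width $a^w=\frac{a^u-a^l}{2}$. For $k\ge 0$, $kA=[ka^l,ka^u]$; for $k<0$, $kA=[ka^u,ka^l]$. The generalized Hukuhara (gH) difference is $A\ominus_{gH}B=[\min\{a^l-b^l,a^u-b^u\},\max\{a^l-b^l,a^u-b^u\}]$. Limits of interval-valued functions are taken with respect to the Hausdorff distance $d_H(A,B)=\max\{|a^l-b^l|,|a^u-b^u|\}$. Order on $\mathbb{I}$: $A\leq^{\min}B$ iff either $a^c<b^c$, or $a^c=b^c$ and $a^w\le b^w$ (a total order); $A<^{\min}B$ iff $A\leq^{\min}B$ and $A\neq B$. An interval-valued function (IVF) on $E\subseteq M$ is a map $f:E\to\mathbb{I}$, written $f(x)=\langle f^c(x),f^w(x)\rangle$, with $f^c,f^w:E\to\mathbb{R}$ and $f^w\ge 0$. $E\subseteq M$ is star-shaped at $x_0\in E$ if for every $x\in E$ and every geodesic $\gamma_{x_0x}:[0,1]\to M$ with $\gamma_{x_0x}(0)=x_0$, $\gamma_{x_0x}(1)=x$, one has $\gamma_{x_0x}(s)\in E$ for all $s\in(0,1)$. For such $E$, a function $h:E\to\mathbb{R}$ is convex at $x_0$ if $h(\gamma_{x_0x}(s))\le(1-s)h(x_0)+s\,h(x)$ for all $x\in E$, all geodesics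 $\gamma_{x_0x}$ emanating from $x_0$ and terminating at $x$ and all $s\in(0,1)$; it is strictly convex at $x_0$ if the inequality is strict for all $x\in E$ with $x\neq x_0$, all such geodesics and all $s\in(0,1)$. An IVF $f$ is cw-convex (strictly cw-convex) at $x_0$ if $f^c$ and $f^w$ are both convex (strictly convex) at $x_0$. $T_x(E)$ denotes the set of tangent vectors to $E$ at $x$; directional derivatives are taken in directions $X_x\in T_x(E)$ for which there is a geodesic $\gamma$ defined on an interval $I\ni 0$ containing some $s>0$, with $\gamma(I)\subseteq E$, $\gamma(0)=x$, $\dot\gamma(0)=X_x$. For such a $\gamma$, the gH-directional derivative of an IVF $f$ is $Df(x;X_x)=\lim_{s\to0^+}\frac1s\big(f(\gamma(s))\ominus_{gH}f(x)\big)\in\mathbb{I}$, when this limit exists. $f$ is gH-directionally differentiable at $x$ if $Df(x;X_x)$ exists in every direction $X_x\in T_x(E)$. *)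

(* Defs.v *)
From HB Require Import structures.
From mathcomp Require Import all_boot all_order all_algebra.
From mathcomp Require Import all_classical all_reals all_analysis.

Set Implicit Arguments.
Unset Strict Implicit.
Unset Printing Implicit Defensive.

Import Order.TTheory GRing.Theory Num.Theory.
Import numFieldNormedType.Exports.

Local Open Scope classical_set_scope.
Local Open Scope ring_scope.

(** * Closed bounded intervals *)

Record cbi (R : realType) := Cbi {
  lo : R;
  hi : R;
  lo_le_hi : lo <= hi }.

HB.instance Definition _ (R : realType) := gen_eqMixin (cbi R).
HB.instance Definition _ (R : realType) := gen_choiceMixin (cbi R).

Section Intervals.
Variable R : realType.
Implicit Types (A B : cbi R) (k : R).

Definition center A : R := (lo A + hi A) / 2.
Definition halfwidth A : R := (hi A - lo A) / 2.

Lemma scale_pos_subproof k A : 0 <= k -> k * lo A <= k * hi A.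
Proof. by move=> k0; rewrite ler_wpM2l ?lo_le_hi. Qed.

Lemma scale_neg_subproof k A : ~~ (0 <= k) -> k * hi A <= k * lo A.
Proof. by rewrite -ltNge => /ltW k0; rewrite ler_wnM2l ?lo_le_hi. Qed.

Definition iscale k A : cbi R :=
  match boolP (0 <= k) with
  | AltTrue k0 => Cbi (scale_pos_subproof A k0)
  | AltFalse k0 => Cbi (scale_neg_subproof A k0)
  end.

Lemma gHdiff_subproof A B :
  Num.min (lo A - lo B) (hi A - hi B) <= Num.max (lo A - lo B) (hi A - hi B).
Proof. by rewrite ge_min le_max lexx. Qed.

Definition gHdiff A B : cbi R := Cbi (gHdiff_subproof A B).

Definition hausdorff_dist A B : R :=
  Num.max `|lo A - lo B| `|hi A - hi B|.

Definition le_min A B : Prop :=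
  center A < center B \/ (center A = center B /\ halfwidth A <= halfwidth B).

Definition lt_min A B : Prop := le_min A B /\ A <> B.

Definition cbi0 : cbi R := Cbi (lexx 0).

End Intervals.

(** * Smooth manifolds *)

Section Manifolds.
Variables (R : realType) (n : nat).

Fixpoint Ck (k : nat) (U : set 'rV[R]_n) (h : 'rV[R]_n -> R) : Prop :=
  (forall u, U u -> {for u, continuous h}) /\
  if k is k'.+1 then
    forall i : 'I_n, (forall u, U u -> derivable h u (delta_mx 0 i)) /\
      Ck k' U (fun u => 'D_(delta_mx 0 i) h u)
  else True.

(* Only meant for open U. *)
Definition smooth_on (U : set 'rV[R]_n) (h : 'rV[R]_n -> R) : Prop :=
  forall k, Ck k U h.

(* [cmap] and [cinv] are total; their values outside [cdom] and
   [cmap @` cdom] are irrelevant. *)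
Record chart (M : topologicalType) := Chart {
  cdom : set M;
  cmap : M -> 'rV[R]_n;
  cinv : 'rV[R]_n -> M;
  cdom_open : open cdom;
  cimg_open : open (cmap @` cdom);
  cmapK : forall p, cdom p -> cinv (cmap p) = p;
  cmap_continuous : forall p, cdom p -> {for p, continuous cmap};
  cinv_continuous : forall p, cdom p -> {for cmap p, continuous cinv} }.

Definition transition (M : topologicalType) (c d : chart M) :
  'rV[R]_n -> 'rV[R]_n := cmap d \o cinv c.

Record smooth_atlas (M : topologicalType) := SmoothAtlas {
  chart_index : Type;
  chart_of :> chart_index -> chart M;
  atlas_cover : forall p, exists a, cdom (chart_of a) p;
  atlas_smooth : forall (a b : chart_index) (k : 'I_n),
    smooth_on (cmap (chart_of a) @` (cdom (chart_of a) `&` cdom (chart_of b)))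
      (fun u => transition (chart_of a) (chart_of b) u 0 k) }.

(* [gram a u i j] is the metric coefficient g_ij at the point of coordinates
   [u] in the chart [a]. *)
Record riemannian_metric (M : topologicalType) (A : smooth_atlas M) :=
  RiemannianMetric {
  gram : chart_index A -> 'rV[R]_n -> 'M[R]_n;
  gram_smooth : forall a i j,
    smooth_on (cmap (A a) @` cdom (A a)) (fun u => gram a u i j);
  gram_sym : forall a p, cdom (A a) p ->
    (gram a (cmap (A a) p))^T = gram a (cmap (A a) p);
  gram_posdef : forall a p (v : 'rV[R]_n), cdom (A a) p -> v != 0 ->
    0 < (v *m gram a (cmap (A a) p) *m v^T) 0 0;
  gram_change : forall a b p (v w : 'rV[R]_n), cdom (A a) p -> cdom (A b) p ->
    v *m gram a (cmap (A a) p) *m w^T =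
    'D_v (transition (A a) (A b)) (cmap (A a) p)
      *m gram b (cmap (A b) p)
      *m ('D_w (transition (A a) (A b)) (cmap (A a) p))^T }.

Record riemannianManifold := RiemannianManifold {
  carrier :> topologicalType;
  manifold_hausdorff : hausdorff_space carrier;
  manifold_second_countable : @second_countable carrier;
  atlas : smooth_atlas carrier;
  metric : riemannian_metric atlas }.

End Manifolds.

Section Geodesics.
Variables (R : realType) (n : nat) (M : riemannianManifold R n).
Local Notation index := (chart_index (atlas M)).
Local Notation dom a := (cdom (atlas M a)).
Local Notation coords a := (cmap (atlas M a)).

(* A tangent vector is the family of its coordinate vectors in the charts
   around [p], subject to the change-of-coordinates rule; the convention
   [tcoord_out] at the other charts makes the representation unique. *)
Record tangent (p : M) := Tangent {
  tcoord : index -> 'rV[R]_n;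
  tcoord_out : forall a, ~ dom a p -> tcoord a = 0;
  tcoord_change : forall a b, dom a p -> dom b p ->
    tcoord b =
    'D_(tcoord a) (transition (atlas M a) (atlas M b)) (coords a p) }.

(* Christoffel symbol Gamma^k_ij of the Levi-Civita connection. *)
Definition christoffel (a : index) (u : 'rV[R]_n) (i j k : 'I_n) : R :=
  let g := gram (metric M) a in
  2^-1 * \sum_(l < n) invmx (g u) k l *
    ('D_(delta_mx 0 i) (fun v => g v j l) u
     + 'D_(delta_mx 0 j) (fun v => g v i l) u
     - 'D_(delta_mx 0 l) (fun v => g v i j) u).

Definition geodesic_open (J : set R) (gamma : R -> M) : Prop :=
  forall t, J t -> {for t, continuous gamma} /\
    forall a, dom a (gamma t) ->
      let u := coords a \o gamma in
      let u' := derive1 u in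
      [/\ derivable u t 1, derivable u' t 1 &
        forall k : 'I_n, derive1 u' t 0 k +
          \sum_(i < n) \sum_(j < n)
            christoffel a (u t) i j k * u' t 0 i * u' t 0 j = 0].

(* A geodesic on an arbitrary interval is the restriction of a geodesic on an
   open one. Curves are total functions, whose values away from J play no role. *)
Definition geodesic (I : set R) (gamma : R -> M) : Prop :=
  is_interval I /\
  exists J : set R,
    [/\ open J, is_interval J, I `<=` J & geodesic_open J gamma].

Definition has_velocity (gamma : R -> M) (t : R) (p : M) (X : tangent p) :
  Prop :=
  gamma t = p /\
  forall a, dom a p -> is_derive t 1 (coords a \o gamma) (tcoord X a).

Definition complete_manifold : Prop :=
  forall (p : M) (X : tangent p),
    exists gamma : R -> M, geodesic setT gamma /\ has_velocity gamma 0 X.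

Definition geodesic_joining (x y : M) (gamma : R -> M) : Prop :=
  [/\ geodesic `[0, 1] gamma, gamma 0 = x & gamma 1 = y].

(** * Convexity at a point *)

Definition star_shaped (E : set M) (x0 : M) : Prop :=
  E x0 /\ forall x gamma, E x -> geodesic_joining x0 x gamma ->
    forall s, 0 < s < 1 -> E (gamma s).

Definition convex_at (E : set M) (x0 : M) (h : M -> R) : Prop :=
  forall x gamma, E x -> geodesic_joining x0 x gamma ->
    forall s, 0 < s < 1 -> h (gamma s) <= (1 - s) * h x0 + s * h x.

Definition strictly_convex_at (E : set M) (x0 : M) (h : M -> R) : Prop :=
  forall x gamma, E x -> x <> x0 -> geodesic_joining x0 x gamma ->
    forall s, 0 < s < 1 -> h (gamma s) < (1 - s) * h x0 + s * h x.

(* Functions on [E] are represented by total functions on [M], of which only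
   the values on [E] are ever used. *)
Definition cw_convex_at (E : set M) (x0 : M) (f : M -> cbi R) : Prop :=
  convex_at E x0 (fun x => center (f x)) /\
  convex_at E x0 (fun x => halfwidth (f x)).

Definition strictly_cw_convex_at (E : set M) (x0 : M) (f : M -> cbi R) :
  Prop :=
  strictly_convex_at E x0 (fun x => center (f x)) /\
  strictly_convex_at E x0 (fun x => halfwidth (f x)).

(** * gH-directional derivatives *)

Definition admissible_curve (E : set M) (x : M) (X : tangent x)
    (I : set R) (gamma : R -> M) : Prop :=
  [/\ I 0, (exists2 s, I s & 0 < s), geodesic I gamma,
      (forall s, I s -> E (gamma s)) & has_velocity gamma 0 X].

Definition tangent_set (E : set M) (x : M) : set (tangent x) :=
  [set X | exists I gamma, admissible_curve E X I gamma].

Arguments tangent_set : clear implicits.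

(* The limit does not depend on the curve, as geodesics with the same initial
   velocity agree near 0. *)
Definition is_gHderiv (E : set M) (f : M -> cbi R) (x : M) (X : tangent x)
    (D : cbi R) : Prop :=
  tangent_set E x X /\
  forall I gamma, admissible_curve E X I gamma ->
    hausdorff_dist (iscale s^-1 (gHdiff (f (gamma s)) (f x))) D
      @[s --> 0^'+] --> (0 : R).

Definition gHderiv (E : set M) (f : M -> cbi R) (x : M) (X : tangent x) :
  cbi R := xget (cbi0 R) [set D | is_gHderiv E f X D].

Definition gH_differentiable (E : set M) (f : M -> cbi R) (x : M) : Prop :=
  forall X : tangent x, tangent_set E x X ->
    exists D, is_gHderiv E f X D.

(* The collection Gamma_0, for geodesics with initial velocity X. *)
Definition Gamma0 (E : set M) (x0 x : M) (X : tangent x0) (gamma : R -> M) :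
  Prop :=
  [/\ geodesic_joining x0 x gamma, has_velocity gamma 0 X
    & tangent_set E x0 X].

Definition width_nondecreasing (E : set M) (x0 : M) (f : M -> cbi R) : Prop :=
  forall (I : set R) (gamma : R -> M) (X : tangent x0),
    geodesic I gamma -> I 0 -> (forall s, I s -> E (gamma s)) ->
    has_velocity gamma 0 X -> tangent_set E x0 X ->
    forall s t, I s -> I t -> 0 <= s -> s <= t ->
      halfwidth (f (gamma s)) <= halfwidth (f (gamma t)).

End Geodesics.

(* Main.v *)
Require Import Defs.
From mathcomp Require Import all_boot all_order all_algebra.
From mathcomp Require Import all_classical all_reals all_analysis.
From mathcomp Require Import ring lra.

Set Implicit Arguments.
Unset Strict Implicit.
Unset Printing Implicit Defensive.

Import Order.TTheory GRing.Theory Num.Theory.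
Import numFieldNormedType.Exports.
Import Defs.

Local Open Scope classical_set_scope.
Local Open Scope ring_scope.

(** Write c and w for center and half-width, and let q_phi(s) be the quotient
    (phi(f(gamma s)) - phi(f x0)) / s for phi = c or w.  The gH-difference
    subtracts centers, and it also subtracts half-widths as long as the second
    interval is not the wider one; the monotonicity hypothesis on w along
    geodesics guarantees this.  Hence the interval quotient
    s^-1 (f(gamma s) gH-minus f(x0)) has center q_c(s) and half-width q_w(s).
    As c and w are 1-Lipschitz for the Hausdorff distance, an upper bound for
    q_c (resp. q_w) near 0+ bounds the center (resp. the half-width) of the
    directional derivative ([hausdorff_limit_le]).

    Convexity at x0 along gamma says exactly that q_c(s) <= q_c(1) and
    q_w(s) <= q_w(1) for 0 < s < 1.  Passing to the limit gives both
    coordinates of the derivative at most those of f(x) gH-minus f(x0), which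
    implies the lexicographic inequality (i).

    For (ii) it suffices to make the inequality between centers strict, but
    the limit of the strict inequalities q_c(s) < q_c(1) is only weak.  So an
    intermediate r is used: q_c(s) <= q_c(r) < q_c(1) for s < r.  The first
    inequality is convexity along the initial piece t |-> gamma(r t), which is
    again a geodesic because the geodesic equation is homogeneous of degree
    two in d/dt ([geodesic_joining_initial]).  Strict convexity speaks only of
    end points other than x0, so r must satisfy gamma(r) <> x0; if no such r
    existed, q_c would vanish on (0, 1), and the strict inequality at 1/2
    would still give 0 < q_c(1) ([center_gHderiv_lt]). *)

(** * Centers and half-widths under interval operations *)

Section IntervalArithmetic.
Context {R : realType}.
Implicit Types (A B D : cbi R) (k m : R).

Lemma iscale_ge0_bounds k A : 0 <= k ->
  lo (iscale k A) = k * lo A /\ hi (iscale k A) = k * hi A.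
Proof.
move=> k0; rewrite /iscale.
(* The sign test must stay abstract only where it indexes the case analysis,
   since the proofs inside the branches mention it as well. *)
have branch b (p : alt_spec (0 <= k) (0 <= k) b) :
    let B := match p with
             | AltTrue k_ge0 => Cbi (scale_pos_subproof A k_ge0)
             | AltFalse k_lt0 => Cbi (scale_neg_subproof A k_lt0)
             end in
    lo B = k * lo A /\ hi B = k * hi A.
  by case: p => // k_lt0; case/negP: (k_lt0).
exact: (branch _ (boolP (0 <= k))).
Qed.

Lemma center_iscale_ge0 k A : 0 <= k -> center (iscale k A) = k * center A.
Proof.
by move=> /iscale_ge0_bounds-/(_ A)[lE hE]; rewrite /center lE hE -mulrDr mulrA.
Qed.

Lemma halfwidth_iscale_ge0 k A :
  0 <= k -> halfwidth (iscale k A) = k * halfwidth A.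
Proof.
move=> /iscale_ge0_bounds-/(_ A)[lE hE].
by rewrite /halfwidth lE hE -mulrBr mulrA.
Qed.

Lemma center_gHdiff A B : center (gHdiff A B) = center A - center B.
Proof. by rewrite /center /gHdiff/= addr_min_max; lra. Qed.

(** Without the hypothesis the half-width of the gH-difference is the absolute
    value of this difference; this is where monotonicity of the width along
    geodesics enters. *)
Lemma halfwidth_gHdiff A B : halfwidth B <= halfwidth A ->
  halfwidth (gHdiff A B) = halfwidth A - halfwidth B.
Proof.
rewrite /halfwidth /gHdiff/= => BA.
have le_end : lo A - lo B <= hi A - hi B by lra.
by rewrite (min_idPl le_end) (max_idPr le_end); lra.
Qed.

Lemma hausdorff_dist_bounds A B :
  `|lo A - lo B| <= hausdorff_dist A B /\ `|hi A - hi B| <= hausdorff_dist A B.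
Proof. by rewrite /hausdorff_dist !le_max !lexx orbT. Qed.

Lemma center_le_hausdorff A B : center B <= center A + hausdorff_dist A B.
Proof.
have [] := hausdorff_dist_bounds A B; rewrite /center !ler_norml.
by move=> /andP[? ?] /andP[? ?]; lra.
Qed.

Lemma halfwidth_le_hausdorff A B :
  halfwidth B <= halfwidth A + hausdorff_dist A B.
Proof.
have [] := hausdorff_dist_bounds A B; rewrite /halfwidth !ler_norml.
by move=> /andP[? ?] /andP[? ?]; lra.
Qed.

(** A functional that is 1-Lipschitz for the Hausdorff distance preserves upper
    bounds in the limit.  It is applied to the center and to the half-width,
    which avoids computing the limits of the two real quotients. *)
Lemma hausdorff_limit_le (phi : cbi R -> R) (A : R -> cbi R) D m :
  (forall B C, phi C <= phi B + hausdorff_dist B C) ->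
  hausdorff_dist (A s) D @[s --> 0^'+] --> (0 : R) ->
  (\forall s \near 0^'+, phi (A s) <= m) -> phi D <= m.
Proof.
move=> phi_lip AD Am; rewrite -[leRHS]addr0.
have limD : m + hausdorff_dist (A s) D @[s --> 0^'+] --> m + 0.
  by apply: cvgD => //; exact: cvg_cst.
rewrite -(cvg_lim _ limD)//; apply: limr_ge; first by apply/cvg_ex; exists (m + 0).
by near=> s; apply: (le_trans (phi_lip (A s) D)); rewrite lerD2r; near: s.
Unshelve. all: by end_near. Qed.

End IntervalArithmetic.

(** * Rescaling the parameter of a geodesic *)

Section Rescaling.
Context {R : realType}.

Lemma derivable_comp_mull (V : normedModType R) (u : R -> V) (r t : R) :
  derivable u (r * t) 1 ->
  derivable (u \o *%R r) t 1 /\ derive1 (u \o *%R r) t = r *: derive1 u (r * t).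
Proof.
move=> /derivable1_diffP du.
have dm : differentiable ( *%R r : R -> R) t by apply/derivable1_diffP.
have duc : differentiable (u \o *%R r) t by exact: differentiable_comp.
split; first exact/derivable1_diffP.
rewrite !derive1E' // diff_comp //=.
have -> : 'd ( *%R r : R -> R) t 1 = r *: (1 : R).
  rewrite -derive1E' // derive1E.
  by rewrite deriveM // derive_id derive_cst; rewrite scaler0 addr0.
by rewrite linearZ.
Qed.

Context {n : nat} {M : riemannianManifold R n}.

(** In coordinates the rescaled curve has velocity r u'(r t) and acceleration
    r^2 u''(r t), so both terms of the geodesic equation are multiplied by r^2:
    the Christoffel term is quadratic in the velocity. *)
Lemma geodesic_open_rescale (J : set R) (gamma : R -> M) (r : R) :
  open J -> geodesic_open J gamma ->
  geodesic_open [set t | J (r * t)] (gamma \o *%R r).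
Proof.
move=> oJ gJ t /= Jt; have [cg eqg] := gJ _ Jt.
have cm : {for t, continuous ( *%R r : R -> R)} by exact: mulrl_continuous.
have cgr : {for t, continuous (gamma \o *%R r)} by exact: continuous_comp.
split; first exact: cgr.
move=> a da; have [du d2u eqk] := eqg _ da.
(* The chart a is valid, and the coordinates of gamma differentiable, in a
   neighbourhood of r t; this is needed to differentiate the rescaled velocity
   as a function, not only to compute its value at t. *)
have d1 : \forall s \near t, derivable (cmap (atlas M a) \o gamma) (r * s) 1.
  have Js : \forall s \near t, J (r * s).
    by apply: cm; exact: open_nbhs_nbhs.
  have ds : \forall s \near t, cdom (atlas M a) (gamma (r * s)).
    by apply: cgr; apply: open_nbhs_nbhs; split=> //; exact: cdom_open.
  near=> s.
  have Jrs : J (r * s) by near: s.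
  by case: (gJ _ Jrs) => _ /(_ a) []//; near: s.
set u := cmap (atlas M a) \o gamma in du d2u eqk d1.
have u1 : \forall s \near t, derive1 (u \o *%R r) s = r *: derive1 u (r * s).
  by apply: filterS d1 => s /derivable_comp_mull[].
have [d2v d2vE] := derivable_comp_mull d2u.
have d2r : derivable (fun s => r *: derive1 u (r * s)) t 1.
  exact: (derivableZ d2v).
have d2 : derivable (derive1 (u \o *%R r)) t 1.
  by apply: near_eq_derivable d2r; apply: filterS u1 => s ->.
have d2E : derive1 (derive1 (u \o *%R r)) t =
    r *: (r *: derive1 (derive1 u) (r * t)).
  rewrite derive1E (near_eq_derive _ u1) -d2vE derive1E.
  exact: (deriveZ r d2v).
split; [by case: (derivable_comp_mull du)|exact: d2|].
move=> k; rewrite compA -/u d2E (nbhs_singleton u1).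
rewrite -[RHS](mulr0 (r * r)) -[X in _ = r * r * X](eqk k) mulrDr.
congr +%R; first by rewrite !mxE mulrA.
rewrite mulr_sumr; apply: eq_bigr => i _.
rewrite mulr_sumr; apply: eq_bigr => j _; rewrite !mxE/=; ring.
Unshelve. all: by end_near. Qed.

Lemma geodesic_joining_initial (x y : M) (gamma : R -> M) (r : R) :
  0 <= r <= 1 -> geodesic_joining x y gamma ->
  geodesic_joining x (gamma r) (gamma \o *%R r).
Proof.
move=> /andP[r0 r1] [[_ [J [oJ iJ IJ gJ]]] g0 g1].
split; rewrite /= ?mulr0 ?mulr1//; split; first exact: interval_is_interval.
exists [set t | J (r * t)]; split.
- by apply: open_comp => // t _; exact: mulrl_continuous.
- move=> s t /= Js Jt w /andP[sw wt]; apply: (iJ _ _ Js Jt).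
  by rewrite !ler_wpM2l.
- move=> s /=; rewrite in_itv/= => /andP[s0 s1]; apply: IJ.
  by rewrite /= in_itv/= mulr_ge0//= mulr_ile1.
- exact: geodesic_open_rescale.
Qed.

End Rescaling.

(** * The directional derivative along a joining geodesic *)

Section DirectionalDerivative.
Context {R : realType} {n : nat} {M : riemannianManifold R n}.
Variables (E : set M) (x0 x : M) (f : M -> cbi R).
Variables (X : tangent x0) (gamma : R -> M).
Hypotheses (hE : star_shaped E x0) (hd : gH_differentiable E f x0).
Hypotheses (Ex : E x) (hgamma : Gamma0 E x X gamma).

Lemma star_shaped_segment (s : R) : 0 <= s <= 1 -> E (gamma s).
Proof.
have [[ggeo g0 g1] _ _] := hgamma; have [Ex0 hstar] := hE.
move=> /andP[s0 s1].
have [->|s_neq0] := eqVneq s 0; first by rewrite g0.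
have [->|s_neq1] := eqVneq s 1; first by rewrite g1.
by apply: (hstar _ gamma Ex) => //; rewrite !lt_neqAle eq_sym s_neq0 s0 s_neq1.
Qed.

(** By star-shapedness gamma on [0, 1] is itself an admissible curve with
    velocity X, so it computes the derivative in direction X. *)
Lemma gHderiv_segment :
  hausdorff_dist (iscale s^-1 (gHdiff (f (gamma s)) (f x0))) (gHderiv E f X)
    @[s --> 0^'+] --> (0 : R).
Proof.
have [[ggeo _ _] vel tX] := hgamma.
have [D DX] := hd tX; have [_ limD] : is_gHderiv E f X (gHderiv E f X).
  exact: (xgetPex (cbi0 R)) (ex_intro _ D DX).
apply: (limD `[0, 1]%classic gamma); split=> //.
- by rewrite /= in_itv/= lexx ler01.
- by exists 1; rewrite //= in_itv/= ler01 lexx.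
- by move=> s; rewrite /= in_itv; exact: star_shaped_segment.
Qed.

(** The bound is asked only on an interval (0, r), since in the strict case it
    comes from the piece of gamma that stops at parameter r. *)
Lemma center_gHderiv_le (m r : R) : 0 < r ->
  (forall s, 0 < s < r -> center (f (gamma s)) - center (f x0) <= s * m) ->
  center (gHderiv E f X) <= m.
Proof.
move=> r0 le_m; apply: (hausdorff_limit_le _ gHderiv_segment).
  exact: center_le_hausdorff.
near=> s.
have s0 : 0 < s by [].
rewrite center_iscale_ge0; last by rewrite invr_ge0 ltW.
rewrite center_gHdiff ler_pdivrMl//.
by apply: le_m; rewrite s0/=; near: s; exact: nbhs_right_lt.
Unshelve. all: by end_near. Qed.

Hypothesis hw : width_nondecreasing E x0 f.

Lemma halfwidth_ge_start (s : R) : 0 <= s <= 1 ->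
  halfwidth (f x0) <= halfwidth (f (gamma s)).
Proof.
move=> Is; have [[ggeo g0 _] vel tX] := hgamma.
rewrite -g0; apply: (hw (I := `[0, 1]%classic) ggeo _ _ vel tX) => //.
- by rewrite /= in_itv/= lexx ler01.
- by move=> t; rewrite /= in_itv; exact: star_shaped_segment.
- by rewrite /= in_itv/= lexx ler01.
- by case/andP: Is.
Qed.

Lemma halfwidth_gHderiv_le (m : R) :
  (forall s, 0 < s < 1 -> halfwidth (f (gamma s)) - halfwidth (f x0) <= s * m) ->
  halfwidth (gHderiv E f X) <= m.
Proof.
move=> le_m; apply: (hausdorff_limit_le _ gHderiv_segment).
  exact: halfwidth_le_hausdorff.
near=> s.
have s0 : 0 < s by [].
have s1 : s < 1 by near: s; exact: nbhs_right_lt.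
rewrite halfwidth_iscale_ge0; last by rewrite invr_ge0 ltW.
rewrite halfwidth_gHdiff; last first.
  by apply: halfwidth_ge_start; rewrite !ltW.
by rewrite ler_pdivrMl//; apply: le_m; rewrite s0.
Unshelve. all: by end_near. Qed.

Lemma gHderiv_le_min : cw_convex_at E x0 f ->
  le_min (gHderiv E f X) (gHdiff (f x) (f x0)).
Proof.
move=> [ccvx wcvx]; have [join vel tX] := hgamma.
have cle : center (gHderiv E f X) <= center (gHdiff (f x) (f x0)).
  rewrite center_gHdiff; apply: (center_gHderiv_le ltr01) => s s01.
  by have := ccvx x gamma Ex join s s01; lra.
have wle : halfwidth (gHderiv E f X) <= halfwidth (gHdiff (f x) (f x0)).
  have [_ _ g1] := join; rewrite halfwidth_gHdiff; last first.
    by rewrite -g1; apply: halfwidth_ge_start; rewrite ler01 lexx.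
  apply: halfwidth_gHderiv_le => s s01.
  by have := wcvx x gamma Ex join s s01; lra.
by move: cle; rewrite le_eqVlt => /orP[/eqP|]; [right|left].
Qed.

(** The strict inequality survives the limit because the quotients at small s
    are all bounded by the quotient at one fixed parameter r, which is strictly
    below the value at 1. *)
Lemma center_gHderiv_lt :
  strictly_convex_at E x0 (fun y => center (f y)) -> x <> x0 ->
  center (gHderiv E f X) < center (f x) - center (f x0).
Proof.
move=> ccvx xx0; have [join vel tX] := hgamma.
have cltx s : 0 < s < 1 ->
    center (f (gamma s)) - center (f x0) < s * (center (f x) - center (f x0)).
  by move=> s01; have := ccvx x gamma Ex xx0 join s s01; lra.
have [[r r01 gr]|stay] := pselect (exists2 r, 0 < r < 1 & gamma r <> x0).
  have /andP[r0 r1] := r01; have r01' : 0 <= r <= 1 by rewrite !ltW.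
  apply: (@le_lt_trans _ _ ((center (f (gamma r)) - center (f x0)) / r)).
    apply: (center_gHderiv_le r0) => s /andP[s0 sr].
    (* gamma s is the point of parameter s / r on the piece ending at gamma r. *)
    have sr01 : 0 < s / r < 1 by rewrite divr_gt0//= ltr_pdivrMr// mul1r.
    have Egr : E (gamma r) by exact: star_shaped_segment.
    have := ccvx _ _ Egr gr (geodesic_joining_initial r01' join) _ sr01.
    rewrite /= mulrC divfK ?gt_eqF// => /ltW.
    set cs := center (f (gamma s)); set cr := center (f (gamma r)).
    set c0 := center (f x0) => h.
    have -> : s * ((cr - c0) / r) = s / r * (cr - c0) by ring.
    by lra.
  by rewrite ltr_pdivrMr// mulrC; exact: cltx.
(* A curve staying at x0 on (0, 1) is excluded by continuity at 1, but the
   estimate also holds for it directly, all the quotients being 0. *)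
have g_const s : 0 < s < 1 -> gamma s = x0.
  by move=> s01; apply: contrapT => gs; apply: stay; exists s.
have half01 : 0 < (2^-1 : R) < 1 by lra.
apply: (@le_lt_trans _ _ 0).
  apply: (center_gHderiv_le ltr01) => s s01.
  by rewrite g_const // subrr mulr0.
by have := cltx _ half01; rewrite g_const// subrr; lra.
Qed.

Lemma gHderiv_lt_min : strictly_cw_convex_at E x0 f -> x <> x0 ->
  lt_min (gHderiv E f X) (gHdiff (f x) (f x0)).
Proof.
move=> [ccvx _] xx0; have := center_gHderiv_lt ccvx xx0.
rewrite -center_gHdiff => clt; split; first by left.
by move=> eqD; move: clt; rewrite eqD ltxx.
Qed.

End DirectionalDerivative.

Theorem theorem4p2 (R : realType) (n : nat) (M : riemannianManifold R n)
    (hM : complete_manifold M) (E : set M) (x0 : M)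
    (hE : star_shaped E x0) (f : M -> cbi R)
    (hw : width_nondecreasing E x0 f)
    (hd : gH_differentiable E f x0) :
  (cw_convex_at E x0 f ->
    forall (x : M) (X : tangent x0) (gamma : R -> M),
      E x -> Gamma0 E x X gamma ->
      le_min (gHderiv E f X) (gHdiff (f x) (f x0))) /\
  (strictly_cw_convex_at E x0 f ->
    forall (x : M) (X : tangent x0) (gamma : R -> M),
      E x -> x <> x0 -> Gamma0 E x X gamma ->
      lt_min (gHderiv E f X) (gHdiff (f x) (f x0))).
Proof.
split=> fcvx x X gamma Ex.
- by move=> hgamma; exact: gHderiv_le_min hgamma _ _.
- by move=> xx0 hgamma; exact: gHderiv_lt_min hgamma _ _.
Qed.
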